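(* Let $X$ and $Y$ be non-empty topological spaces and let $X\times Y$ be equipped with a $\mathcal C$-cross topology such that the family $\mathcal C$ contains a $\pi$-network for the product topology $\tau$ on $X\times Y$. Assume that $\pi(Y)<\mathrm{cov}(\mathcal M_X)$. Let $\lambda$ be any cardinal number with $\lambda<\min\{\mathrm{cov}(\mathcal M_X),\mathrm{cov}(\mathcal M_Y)\}$. If $\{E_\alpha\subseteq X\times Y:\alpha<\lambda\}$ is a family of sets which are open and dense with respect to the $\mathcal C$-cross topology, then the intersection $\bigcap\{E_\alpha:\alpha<\lambda\}$ is non-empty.
   Context: For $G\subseteq X\times Y$, $G_x=\{y\in Y:(x,y)\in G\}$ denotes the vertical section at $x\in X$ and $G^y=\{x\in X:(x,y)\in G\}$ the horizontal section at $y\in Y$. $\mathcal C$-cross topology: let $\mathcal C$ be a family of subsets of $X\times Y$ which is closed under finite intersections and such that for each $G\in\mathcal C$ every non-empty vertical section $G_x$ has non-empty interior in $Y$ and every non-empty horizontal section $G^y$ has non-empty interior in $X$. The $\mathcal C$-cross topology is the topology on $X\times Y$ generated by $\mathcal C$, for which $\mathcal C$ is a base. A $\pi$-network for a topology is a family of non-empty sets such that every non-empty open set contains a member of the family. A $\pi$-base is a $\pi$-network consisting of open sets. $\pi(Y)$ is the minimal cardinality of a $\pi$-base for $Y$. $\mathcal M_X$ is the $\sigma$-ideal of meager subsets of a space $X$. For a family $\mathcal F$ of subsets of a set $X$ with $X=\bigcup\mathcal F$, $\mathrm{cov}(\mathcal F)$ is the minimal cardinality of a subfamily $\mathcal W\subseteq\mathcal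 F$ with $\bigcup\mathcal W=X$; writing $\mathrm{cov}(\mathcal M_X)$ and $\mathrm{cov}(\mathcal M_Y)$ presupposes $X=\bigcup\mathcal M_X$ and $Y=\bigcup\mathcal M_Y$. Cardinal invariants are by convention assumed infinite (a finite value is read as $\omega$). *)

(* Defs.v *)
(* A cardinal number is represented by any type of that cardinality. *)
From HB Require Import structures.
From mathcomp Require Import all_boot all_order all_algebra.
From mathcomp Require Import all_classical.
From mathcomp Require Import topology.

Set Implicit Arguments.
Unset Strict Implicit.
Unset Printing Implicit Defensive.

Local Open Scope classical_set_scope.
Local Open Scope card_scope.

Definition card_lt (K L : Type) : Prop :=
  ([set: K] #<= [set: L]) /\ ~ ([set: K] #= [set: L]).

Definition least_card (T : Type) (P : set (set T)) : set (set T) :=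
  [set A | P A /\ forall B, P B -> A #<= B].

(* In a maximal set F of choice functions on P that pairwise differ at every
   index, evaluation at some A in P is a bijection from F onto A. *)
Lemma least_card_ex (T : Type) (P : set (set T)) :
  P !=set0 -> least_card P !=set0.
Proof.
move=> [A0 PA0].
pose I := {A : set T | P A}.
pose D := {F : set (I -> T) |
  (forall f i, F f -> sval i (f i)) /\
  (forall f g i, F f -> F g -> f i = g i -> f = g)}.
pose R (F G : D) := `[< sval F `<=` sval G >].
have [F maxF] : exists F : D, forall G, R F G -> G = F.
  apply: (@Zorn D R).
  - by move=> F; apply/asboolP.
  - move=> F G H /asboolP FG /asboolP GH; apply/asboolP.
    exact: subset_trans GH.
  - move=> [F pF] [G pG] /asboolP/= FG /asboolP/= GF.
    have E : F = G by apply/seteqP.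
    move: pG GF FG; rewrite -E => pG _ _; congr exist; exact: Prop_irrelevance.
  - move=> C totC.
    have pU : (forall f i, (\bigcup_(F in C) sval F) f -> sval i (f i)) /\
        (forall f g i, (\bigcup_(F in C) sval F) f ->
           (\bigcup_(F in C) sval F) g -> f i = g i -> f = g).
      split; first by move=> f i [F _ Ff]; exact: (svalP F).1 Ff.
      move=> f g i [F CF Ff] [G CG Gg] fg.
      have [/asboolP FG|/asboolP GF] := totC F G CF CG.
        exact: (svalP G).2 (FG _ Ff) Gg fg.
      exact: (svalP F).2 Ff (GF _ Gg) fg.
    by exists (exist _ (\bigcup_(F in C) sval F) pU : D) => F CF; apply/asboolP => f Ff /=; exists F.
have [injF1 injF2] := svalP F.
suff [i surj] : exists i : I,
    forall t, sval i t -> exists2 f, sval F f & f i = t.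
  exists (sval i); split; first exact: svalP i.
  move=> B PB.
  have /choice[h hP] : forall t, exists f, sval i t -> sval F f /\ f i = t.
    move=> t; have [it|nit] := pselect (sval i t).
      by have [f Ff fit] := surj t it; exists f.
    by exists (fun=> t) => /nit.
  pose j : I := exist _ B PB.
  have hinj : {in sval i &, injective (fun t => h t j)}.
    move=> s t /set_mem/hP[Fs hs] /set_mem/hP[Ft ht] hst.
    by move: hs ht; rewrite (injF2 _ _ _ Fs Ft hst) => <- ->.
  rewrite -(card_le_eql (inj_card_eq hinj)); apply: subset_card_le.
  by move=> _ [t /hP[Ft _] <-]; exact: injF1 j Ft.
apply: contrapT => nsurj.
have /choice[g gP] : forall i : I, exists t,
    sval i t /\ forall f, sval F f -> f i <> t.
  move=> i; apply: contrapT => ni; apply: nsurj; exists i => t it.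
  apply: contrapT => nt; apply: ni; exists t; split=> // f Ff fit.
  by apply: nt; exists f.
have pG : (forall f i, (sval F `|` [set g]) f -> sval i (f i)) /\
    (forall f f' i, (sval F `|` [set g]) f -> (sval F `|` [set g]) f' ->
       f i = f' i -> f = f').
  split=> [f i [/injF1//|->]|f f' i]; first exact: (gP i).1.
  move=> [Ff|->] [Ff'|->] //; first exact: injF2.
    by move/((gP i).2 f Ff).
  by move/esym/((gP i).2 f' Ff').
have FG : (exist _ (sval F `|` [set g]) pG : D) = F by apply: maxF; apply/asboolP => f Ff /=; left.
have Fg : sval F g by rewrite -FG /=; right.
exact: (gP (exist _ A0 PA0)).2 Fg erefl.
Qed.

(* The minimal cardinality of a member of P, a finite value being read as
   omega. *)
Definition min_card (T : Type) (P : set (set T)) : Type :=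
  let A := xget set0 (least_card P) in
  if pselect (finite_set A) then (nat : Type) else set_type A.

Section Invariants.
Context {T : topologicalType}.

Definition pi_network (N : set (set T)) : Prop :=
  (forall A, N A -> A !=set0) /\
  forall U, open U -> U !=set0 -> exists2 A, N A & A `<=` U.

Definition pi_base (B : set (set T)) : Prop := pi_network B /\ B `<=` open.

Definition nowhere_dense (A : set T) : Prop := (closure A)° = set0.

Definition meager : set (set T) :=
  [set A | exists2 F : nat -> set T,
    forall n, nowhere_dense (F n) & A = \bigcup_n F n].

End Invariants.

Definition pi_weight (T : topologicalType) : Type := min_card (@pi_base T).

Definition covers (T : Type) (W : set (set T)) : Prop :=
  \bigcup_(A in W) A = setT.

Definition cov (T : Type) (F : set (set T)) : Type :=
  min_card [set W | W `<=` F /\ covers W].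

(* Closure under binary intersections together with cross_covers makes the
   family a base of a topology. *)
Record cross_family (X Y : topologicalType) := CrossFamily {
  cross_sets : set (set (X * Y));
  cross_setI : setI_closed cross_sets;
  cross_covers : covers cross_sets;
  cross_xsection : forall G x, cross_sets G ->
    xsection G x !=set0 -> (xsection G x)° !=set0;
  cross_ysection : forall G y, cross_sets G ->
    ysection G y !=set0 -> (ysection G y)° !=set0 }.

(* An alias of X * Y, so that its topology is not the product topology. *)
Definition cross_space (X Y : topologicalType) (C : cross_family X Y) : Type :=
  (X * Y)%type.

Section CrossTopology.
Context (X Y : topologicalType) (C : cross_family X Y).

HB.instance Definition _ := Choice.on (cross_space C).

Let cross_join (G H : set (X * Y)) t :
  cross_sets C G -> cross_sets C H -> G t -> H t ->
  exists K, [/\ cross_sets C K, K t & K `<=` G `&` H].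
Proof.
by move=> CG CH Gt Ht; exists (G `&` H); split=> //; exact: cross_setI.
Qed.

HB.instance Definition _ := @isBaseTopological.Build (cross_space C)
  (set (X * Y)) (cross_sets C) id (@cross_covers X Y C) cross_join.

End CrossTopology.

Lemma cross_openE (X Y : topologicalType) (C : cross_family X Y)
    (U : set (cross_space C)) :
  open U <-> exists2 D, D `<=` cross_sets C & \bigcup_(G in D) G = U.
Proof. by []. Qed.

(* Main.v *)
(* Fix a pi-base B of Y with at most pi(Y) members. For every a and every V in
   B, the set of all x such that the interior of the vertical section of E a at
   x meets V has dense interior in X: a network member inside U x V meets E a
   in some G in C, whose projection to X contains a horizontal section of G.
   There are at most |Lambda| * pi(Y) < cov(M_X) such sets, the product being
   below cov(M_X) by Hessenberg's theorem; hence some x lies in all of them.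
   At this x all the sections of the E a have dense interior in Y, and
   |Lambda| < cov(M_Y) gives a common point y of these interiors. *)
Require Import Defs.
From mathcomp Require Import all_boot all_order all_algebra.
From mathcomp Require Import all_classical.
From mathcomp Require Import topology.
From mathcomp Require Import wochoice.

Local Open Scope classical_set_scope.
Local Open Scope card_scope.

(** * Cardinal arithmetic up to Hessenberg's theorem *)

Lemma set_inj_card_le {T U : Type} {A : set T} {B : set U} (f : T -> U) :
  {in A &, injective f} -> f @` A `<=` B -> A #<= B.
Proof.
move=> finj fAB; rewrite -(card_le_eql (inj_card_eq finj)).
exact: subset_card_le.
Qed.

Lemma card_le_set_inj {T U : Type} {A : set T} {B : set U} :
  A !=set0 -> A #<= B ->
  exists2 f : T -> U, {in A &, injective f} & f @` A `<=` B.
Proof.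
elim/Ppointed: U => U in B *.
  by rewrite (empty_eq0 B) card_le0 => -[x Ax] /eqP A0; rewrite A0 in Ax.
move=> _ /pcard_leP[f]; exists f; first exact: inj.
by move=> _ [x Ax <-]; exact: funS.
Qed.

Lemma card_le_setX {T T' U U' : Type} {A : set T} {A' : set T'}
    {B : set U} {B' : set U'} :
  A #<= A' -> B #<= B' -> A `*` B #<= A' `*` B'.
Proof.
have [->|/set0P A0 AA'] := eqVneq A set0; first by rewrite set0X card_ge0.
have [->|/set0P B0 BB'] := eqVneq B set0; first by rewrite setX0 card_ge0.
have [f finj fA] := card_le_set_inj A0 AA'.
have [g ginj gB] := card_le_set_inj B0 BB'.
apply: (@set_inj_card_le _ _ _ _ (fun p => (f p.1, g p.2))).
  move=> [x y] [x' y'] /set_mem[/= Ax By] /set_mem[/= Ax' By'] [fxx' gyy'].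
  by congr pair; [apply: finj|apply: ginj]; rewrite ?inE.
move=> _ [[x y] [/= Ax By] <-].
by split=> /=; [apply: fA; exists x|apply: gB; exists y].
Qed.

(** Both types are copied into [K + L], where [least_card_ex] selects the smaller of the two
    copies. *)
Lemma card_le_total (K L : Type) :
  [set: K] #<= [set: L] \/ [set: L] #<= [set: K].
Proof.
pose A : set (K + L) := range inl; pose B : set (K + L) := range inr.
have AK : A #= [set: K] by apply: inj_card_eq => ? ? _ _ [].
have BL : B #= [set: L] by apply: inj_card_eq => ? ? _ _ [].
have [|M [[->|->] M_le]] := @least_card_ex _ [set A; B].
- by exists A; left.
- by left; rewrite -(card_le_eql AK) -(card_le_eqr BL); apply: M_le; right.
- by right; rewrite -(card_le_eql BL) -(card_le_eqr AK); apply: M_le; left.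
Qed.

Lemma card_ltNge (K L : Type) : card_lt K L <-> ~ ([set: L] #<= [set: K]).
Proof.
split=> [[KL nKL] LK|nLK].
  by apply: nKL; rewrite card_eq_le KL LK.
split; first by have [] := card_le_total K L.
by move=> KL; apply: nLK; have := KL; rewrite card_eq_le => /andP[].
Qed.

(** Hilbert's hotel: along a sequence [u] of distinct points of [A], [x] moves to [u 0] and [u n] to
    [u n.+1], while all other points stay fixed. *)
Lemma infinite_card_setU1 {T : Type} (A : set T) (x : T) :
  infinite_set A -> x |` A #<= A.
Proof.
move=> /infiniteP NA.
have [u uinj uA] := card_le_set_inj (ex_intro _ 0%N I) NA.
have {}uA n : A (u n) by apply: uA; exists n.
have {}uinj m n : u m = u n -> m = n by apply: uinj; rewrite inE.
have [Ax|nAx] := pselect (A x).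
  by apply: subset_card_le => y [->|].
have /choice[h hP] : forall y, exists z,
    [\/ y = x /\ z = u 0%N, y <> x /\ exists2 n, y = u n & z = u n.+1 |
        [/\ y <> x, (forall n, y <> u n) & z = y]].
  move=> y; have [->|yx] := pselect (y = x); first by exists (u 0%N); constructor 1.
  have [[n yu]|nyu] := pselect (exists n, y = u n).
    by exists (u n.+1); constructor 2; split=> //; exists n.
  by exists y; constructor 3; split=> // n yu; apply: nyu; exists n.
apply: (@set_inj_card_le _ _ _ _ h).
  move=> y z _ _.
  case: (hP y) => [[-> ->]|[yx [m -> ->]]|[yx yu ->]];
    case: (hP z) => [[-> ->]|[zx [n -> ->]]|[zx zu ->]] //.
  - by move/uinj.
  - by move/esym/zu.
  - by move/uinj.
  - by move/uinj => -[->].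
  - by move/esym/zu.
  - by move/yu.
  - by move/yu.
move=> _ [y xAy <-].
case: (hP y) => [[_ ->]|[_ [n _ ->]]|[yx _ ->]] //.
by case: xAy.
Qed.

(** The strict part of a well-ordering [R]: a minimum of the non-accessible points refutes their
    existence, and minima of [{x, y, z}] and [{x, y}] give transitivity and trichotomy. *)
Lemma wf_total_order (T : Type) : exists lt : T -> T -> Prop,
  [/\ well_founded lt,
      forall x y z, lt x y -> lt y z -> lt x z &
      forall x y, [\/ lt x y, x = y | lt y x]].
Proof.
have [R woR] := well_ordering_principle {classic T}.
have minR (A : set T) : A !=set0 -> exists2 z, A z & forall y, A y -> R z y.
  move=> [x Ax]; have [|z [[Az zmin] _]] := woR (mem A).
    by exists x; exact: mem_set.
  by exists z => [|y Ay]; [exact: set_mem|apply: zmin; exact: mem_set].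
have /= asym := @wo_chain_antisymmetric {classic T} R predT.
have {}asym x y : R x y -> R y x -> x = y.
  move=> xy yx; apply: asym => //; last by rewrite xy yx.
  exact: withinW.
exists (fun x y => R x y /\ x <> y); split.
- move=> x; apply: contrapT => nx.
  have [|z nz zmin] := minR [set y | ~ Acc (fun x y => R x y /\ x <> y) y].
    by exists x.
  apply: nz; constructor => y [yz neq]; apply: contrapT => ny.
  by apply: neq; apply: asym => //; exact: zmin.
- move=> x y z [xy nxy] [yz nyz].
  have [|t + tmin] := minR [set x; y; z]; first by exists x; left; left.
  have tx := tmin x (or_introl (or_introl erefl)).
  have ty := tmin y (or_introl (or_intror erefl)).
  have tz := tmin z (or_intror erefl).
  move=> [[]|] /= E; subst t.
  + by split=> // E; subst z; apply: nxy; exact: asym.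
  + by case: nxy; exact: asym.
  + by case: nyz; exact: asym.
- move=> x y; have [->|xy] := pselect (x = y); first by constructor 2.
  have [|t + tmin] := minR [set x; y]; first by exists x; left.
  have tx := tmin x (or_introl erefl).
  have ty := tmin y (or_intror erefl).
  move=> [] /= E; subst t; first by constructor 1.
  by constructor 3; split=> // E; apply: xy.
Qed.

(* Greedy recursion along lt: each x is sent to an element of B not yet
   used, which exists since the predecessors of x are too few to exhaust B. *)
Lemma wf_card_le (T U : Type) (lt : T -> T -> Prop) (A : set T) (B : set U) :
  well_founded lt -> (forall x y, [\/ lt x y, x = y | lt y x]) ->
  (forall x, A x -> ~ (B #<= [set y | A y /\ lt y x])) -> A #<= B.
Proof.
move=> wf tot small.
have [->|/set0P[a Aa]] := eqVneq A set0; first exact: card_ge0.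
have [b0 Bb0] : B !=set0.
  apply/set0P/eqP => B0; apply: (small a Aa); rewrite B0; exact: card_ge0.
have /choice[c cP] : forall W : set U, exists b, ~ B `<=` W -> B b /\ ~ W b.
  move=> W; have [BW|/existsNP[b /not_implyP[Bb nWb]]] := pselect (B `<=` W).
    by exists b0.
  by exists b.
pose F x (rec : forall y, lt y x -> U) : U :=
  c [set u | exists y (yx : lt y x), A y /\ rec y yx = u].
pose g := Fix wf (fun=> U) F.
have gE x : g x = c (g @` [set y | A y /\ lt y x]).
  rewrite /g Fix_eq.
    rewrite /F; congr c; apply/seteqP; split=> u /=.
      by move=> [y [yx [Ay <-]]]; exists y.
    by move=> [y [Ay yx] <-]; exists y, yx.
  move=> z f f' ff'; rewrite /F; congr c; apply/seteqP; split=> u /=.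
    by move=> [y [yx [Ay <-]]]; exists y, yx; rewrite ff'.
  by move=> [y [yx [Ay <-]]]; exists y, yx; rewrite ff'.
have gP x : A x -> B (g x) /\ ~ (g @` [set y | A y /\ lt y x]) (g x).
  move=> Ax; rewrite gE; apply: cP => Bsub; apply: (small x Ax).
  exact: card_le_trans (subset_card_le Bsub) (card_image_le _ _).
apply: (@set_inj_card_le _ _ _ _ g).
  move=> x y /set_mem Ax /set_mem Ay gxy.
  have [xy|//|yx] := tot x y.
    by case: (gP y Ay) => _ []; exists x.
  by case: (gP x Ax) => _ []; exists y.
by move=> _ [x Ax <-]; exact: (gP x Ax).1.
Qed.

Lemma infinite_card_setX (T : Type) :
  infinite_set [set: T] -> [set: T * T] #<= [set: T].
Proof.
have [lt [wf tr tot]] := wf_total_order T.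
have [lt2 [wf2 _ tot2]] := wf_total_order (T * T).
pose seg x := [set y | lt y x].
(* Stated for down-closed [D] so as to serve twice: for the initial segments, by induction along
   [lt], and then for all of [T]. *)
have step (D : set T) : (forall x y, D x -> lt y x -> D y) ->
    (forall x, D x -> infinite_set (seg x) -> seg x `*` seg x #<= seg x) ->
    infinite_set D -> D `*` D #<= D.
  move=> Ddown Dseg Dinf.
  (* If [D] embeds in one of its own segments, the square of that segment bounds [D * D]. Otherwise
     [D] behaves like an initial ordinal, and [wf_card_le] applies. *)
  have [[x Dx Dsx]|nD] := pselect (exists2 x, D x & D #<= seg x).
    have sinf : infinite_set (seg x) by move=> /(card_le_finite Dsx).
    apply: card_le_trans (card_le_setX Dsx Dsx) _.
    apply: card_le_trans (Dseg x Dx sinf) _.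
    by apply: subset_card_le => y; exact: Ddown.
  (* pairs are ordered by their maximum first, so that the predecessors of p
     lie in the square of the initial segment up to m p *)
  pose m (p : T * T) := if pselect (lt p.1 p.2) then p.2 else p.1.
  have m1 p : m p = p.1 \/ lt p.1 (m p).
    by rewrite /m; case: pselect => /= ?; [right|left].
  have m2 p : m p = p.2 \/ lt p.2 (m p).
    by rewrite /m; case: pselect => /= ?; [left|have [|->|] := tot p.1 p.2; auto].
  (* The well-order [lt2] of the pairs is arbitrary; it breaks ties between equal maxima. *)
  pose prec q p := lt (m q) (m p) \/ m q = m p /\ lt2 q p.
  apply: (@wf_card_le _ _ prec).
  - move=> p; move: {2}(m p) (erefl (m p)) => a; elim/(well_founded_ind wf): a p.
    move=> a IHa p; elim/(well_founded_ind wf2): p => p IHp mp.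
    constructor => q [qp|[qp lqp]]; first by apply: (IHa (m q)); rewrite -?mp.
    by apply: IHp => //; rewrite qp.
  - move=> p q; have [pq|pq|qp] := tot (m p) (m q).
    + by constructor 1; left.
    + have [lpq|->|lqp] := tot2 p q.
      * by constructor 1; right.
      * by constructor 2.
      * by constructor 3; right.
    + by constructor 3; left.
  (* If the predecessors of [p] were as many as [D], then [D] would embed in [cl * cl]. This makes
     [D] finite when [seg (m p)] is finite, and contradicts [nD] otherwise. *)
  move=> p [Dp1 Dp2] Dle.
  have Dm : D (m p) by rewrite /m; case: pselect.
  pose cl := m p |` seg (m p).
  have {}Dle : D #<= cl `*` cl.
    apply: card_le_trans Dle _; apply: subset_card_le => q [_ qp].
    have clm x : m q = x \/ lt x (m q) -> cl x.
      by move=> [<-|xq]; case: qp => [qp|[qp _]]; rewrite /cl /seg /=;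
        [right|left|right; exact: tr qp|right; rewrite -qp].
    by split; exact: clm.
  have [sfin|sinf] := pselect (finite_set (seg (m p))).
    have clfin : finite_set cl.
      by rewrite finite_setU; split=> //; exact: finite_set1.
    by apply: Dinf; apply: card_le_finite Dle _; exact: finite_setX.
  apply: nD; exists (m p) => //; apply: card_le_trans Dle _.
  have clseg := infinite_card_setU1 _ (m p) sinf.
  exact: card_le_trans (card_le_setX clseg clseg) (Dseg _ Dm sinf).
have seg_step x : infinite_set (seg x) -> seg x `*` seg x #<= seg x.
  elim/(well_founded_ind wf): x => x IH; apply: step => [y z yx zy|y yx].
    exact: tr zy yx.
  exact: IH.
by move=> Tinf; rewrite -setXTT; apply: step => // x _; exact: seg_step.
Qed.

(** The product embeds in the square of the larger factor, which is finite or, by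
    [infinite_card_setX], no larger than that factor. *)
Lemma card_lt_prod (K L M : Type) : infinite_set [set: M] ->
  card_lt K M -> card_lt L M -> card_lt (K * L) M.
Proof.
wlog KL : K L / [set: K] #<= [set: L].
  move=> H Minf KM LM; have [KL|LK] := card_le_total K L; first exact: H.
  have /card_ltNge nle := H _ _ LK Minf LM KM.
  apply/card_ltNge => MKL; apply: nle; apply: card_le_trans MKL _.
  by rewrite -!setXTT; apply: (@set_inj_card_le _ _ _ _ (fun p => (p.2, p.1)));
    [move=> [a b] [c d] _ _ [-> ->]|].
move=> Minf /card_ltNge nMK /card_ltNge nML; apply/card_ltNge => MKL.
have {}MKL : [set: M] #<= [set: L * L].
  by apply: card_le_trans MKL _; rewrite -!setXTT; exact: card_le_setX.
have [Lfin|Linf] := pselect (finite_set [set: L]).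
  apply: Minf; apply: card_le_finite MKL _.
  by rewrite -setXTT; exact: finite_setX.
by apply: nML; apply: card_le_trans MKL _; exact: infinite_card_setX.
Qed.

Lemma card_le_lt (K L M : Type) :
  [set: K] #<= [set: L] -> card_lt L M -> card_lt K M.
Proof.
move=> KL /card_ltNge nML; apply/card_ltNge => MK; apply: nML.
exact: card_le_trans MK KL.
Qed.

(** * Minimal cardinalities under the convention that finite values read as omega *)

Lemma min_cardP (T : Type) (P : set (set T)) : P !=set0 ->
  exists A, [/\ least_card P A, A #<= [set: min_card P],
    infinite_set [set: min_card P] &
    [set: min_card P] #<= A \/ finite_set A /\ [set: min_card P] #<= [set: nat]].
Proof.
move=> P0; have [A0 A0least] := least_card_ex P0.
exists (xget set0 (least_card P)); rewrite /min_card; set A := xget _ _.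
have Aleast : least_card P A by exact: (xgetI _ A0least).
case: pselect => /= [Afin|Ainf]; split=> //.
- exact: finite_set_countable.
- exact: infinite_nat.
- by right.
- by rewrite (card_le_eqr (card_setT A)).
- by rewrite (eq_finite_set (card_setT A)).
- by left; rewrite (card_le_eql (card_setT A)).
Qed.

(** An infinite [K] dominates the minimum in both readings: through [A] if the minimum is infinite,
    through [nat] if it is finite. *)
Lemma card_lt_min_card (T K : Type) (P : set (set T)) (A : set T) :
  card_lt K (min_card P) -> P A -> A #<= [set: K] -> finite_set [set: K].
Proof.
move=> /card_ltNge nPK PA AK.
have [|B [[PB Bmin] _ _ BP]] := @min_cardP T P; first by exists A.
apply/finite_setPn => NK; apply: nPK; case: BP => [PB'|[_ PN]].
  exact: card_le_trans PB' (card_le_trans (Bmin _ PA) AK).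
exact: card_le_trans PN NK.
Qed.

(** * Intersections of open dense sets and covers by meager sets *)

Lemma finite_bigcap_dense (T : topologicalType) (K : Type) (A : set K)
    (D : K -> set T) : finite_set A ->
  (forall a, open (D a)) -> (forall a, dense (D a)) ->
  dense (\bigcap_(a in A) D a).
Proof.
move=> + Dopen Ddense => /finite_setP[n].
elim: n A => [|n IHn] A.
  rewrite II0 card_eq0 => /eqP ->; rewrite bigcap_set0 => O O0 _.
  by rewrite setIT.
move=> /eq_cardSP[a Aa /IHn AaD]; rewrite (bigcap_setD1 a)//.
exact: denseI.
Qed.

Lemma open_dense_nowhere_denseC (T : topologicalType) (D : set T) :
  open D -> dense D -> nowhere_dense (~` D).
Proof.
move=> Dopen Ddense; rewrite /nowhere_dense closure_setC ((interior_id D).1 Dopen).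
apply/eqP/contraT => /set0P /Ddense[|x [/interior_subset]//].
exact: open_interior.
Qed.

(* When K is finite, cov may be a finite cardinal read as omega, in which case
   the hypothesis on K carries no information about covers by meager sets. *)
Lemma bigcap_open_dense_neq0 (T : topologicalType) (K : Type) (D : K -> set T) :
  [set: T] !=set0 -> card_lt K (cov (@meager T)) ->
  (forall a, open (D a)) -> (forall a, dense (D a)) -> \bigcap_a D a !=set0.
Proof.
move=> T0 Kcov Dopen Ddense; apply/set0P/negP => /eqP capD0.
(* If the intersection is empty, the complements form a meager cover indexed by [K], which forces
   [K] to be finite; but finitely many open dense sets have dense intersection. *)
have Kfin : finite_set [set: K].
  apply: (card_lt_min_card _ _ _ (range (fun a => ~` D a)) Kcov).
    split=> [_ [a _ <-]|].
      exists (fun=> ~` D a); last by rewrite bigcup_const.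
      by move=> _; exact: open_dense_nowhere_denseC.
    by rewrite /covers bigcup_image -setC_bigcap capD0 setC0.
  exact: card_image_le.
have [] := finite_bigcap_dense _ _ _ _ Kfin Dopen Ddense _ T0 openT.
by rewrite capD0 => x [].
Qed.

(** * Vertical sections of open dense sets in the cross topology *)

Section CrossSpace.
Context (X Y : topologicalType) (C : cross_family X Y).

Lemma cross_sets_open (G : set (cross_space C)) : cross_sets C G -> open G.
Proof.
by move=> CG; apply/cross_openE; exists [set G]; [move=> _ ->|exact: bigcup_set1].
Qed.

(** Cutting [N] with a basic set, not just with [E], keeps [G] in the family, so that its non-empty
    sections have non-empty interior. *)
Lemma cross_dense_subset (E : set (cross_space C)) (N : set (X * Y)) :
  open E -> dense E -> cross_sets C N -> N !=set0 ->
  exists G, [/\ cross_sets C G, G !=set0, G `<=` N & G `<=` E].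
Proof.
move=> /cross_openE[D DC <-] Edense CN N0.
have [p [Np [H DH Hp]]] := Edense N N0 (cross_sets_open _ CN).
exists (N `&` H); split.
- by apply: cross_setI => //; exact: DC.
- by exists p.
- exact: subIsetl.
- by move=> q [_ Hq]; exists H.
Qed.

Lemma interior_xsection_dense (E : set (cross_space C)) (V : set Y) :
  (exists2 N : set (set (X * Y)), N `<=` cross_sets C & pi_network N) ->
  open E -> dense E -> open V -> V !=set0 ->
  dense [set x | (xsection (E : set (X * Y)) x)° `&` V !=set0]°.
Proof.
move=> [N NC [N0 Nnet]] Eopen Edense Vopen [v Vv] U [u Uu] Uopen.
have UVopen : open (U `*` V).
  rewrite openE => -[a b] [Ua Vb]; exists (U, V) => //.
  by split; exact: open_nbhs_nbhs.
have [|A NA AUV] := Nnet _ UVopen; first by exists (u, v).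
have [G [CG [[x y] Gxy] GA GE]] :=
  cross_dense_subset _ _ Eopen Edense (NC _ NA) (N0 _ NA).
have [z zint] : (ysection G y)° !=set0.
  by apply: (cross_ysection CG); exists x; apply/ysectionP.
exists z; split.
  have /ysectionP Gzy := interior_subset zint.
  by have [] := AUV _ (GA _ Gzy).
(* Each point of the section of [G] at [y] has a non-empty vertical section in [G], whose interior
   is contained in [V] and in the section of [E]. *)
move: zint; apply: interiorS => {}x /ysectionP {}Gxy.
have [w wint] : (xsection G x)° !=set0.
  by apply: (cross_xsection CG); exists y; apply/xsectionP.
exists w; split.
  by move: wint; apply: interiorS => ? /xsectionP/GE ?; exact/xsectionP.
have /xsectionP Gxw := interior_subset wint.
by have [] := AUV _ (GA _ Gxw).
Qed.

End CrossSpace.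

(** * A small pi-base of [Y] and the two category arguments, first in [X], then in [Y] *)

Lemma pi_weightP (T : topologicalType) :
  exists2 B : set (set T), pi_base B & B #<= [set: pi_weight T].
Proof.
have [|B [[? _] ? _ _]] := @min_cardP (set T) (@pi_base T); last by exists B.
(* The non-empty open sets form a pi-base, so the minimum is taken over a non-empty collection. *)
exists [set U | open U /\ U !=set0]; split; last by move=> U [].
by split=> [U []//|U Uopen U0]; exists U.
Qed.

Theorem theorem4 (X Y : topologicalType)
    (X_neq0 : [set: X] !=set0) (Y_neq0 : [set: Y] !=set0)
    (C : cross_family X Y)
    (C_network : exists2 N : set (set (X * Y)),
       N `<=` cross_sets C & pi_network N)
    (covX : covers (@meager X)) (covY : covers (@meager Y))
    (piY_lt : card_lt (pi_weight Y) (cov (@meager X)))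
    (Lambda : Type)
    (Lambda_ltX : card_lt Lambda (cov (@meager X)))
    (Lambda_ltY : card_lt Lambda (cov (@meager Y)))
    (E : Lambda -> set (cross_space C))
    (E_open : forall a, open (E a)) (E_dense : forall a, dense (E a)) :
  \bigcap_a E a !=set0.
Proof.
have [B [[B0 Bnet] Bopen] Ble] := pi_weightP Y.
pose Exint a x := (xsection (E a : set (X * Y)) x)°.
have [x xW] : \bigcap_(aV : Lambda * B)
    [set x | Exint aV.1 x `&` val aV.2 !=set0]° !=set0.
  apply: bigcap_open_dense_neq0 => // [|[a V]|[a V]].
  - apply: card_lt_prod => //.
      (* The bound on the product needs [cov (@meager X)] to be infinite, which the omega convention
         ensures. *)
      have [|? [_ _ covinf _]] := @min_cardP _
        [set W | W `<=` @meager X /\ covers W]; first by exists (@meager X); split.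
      exact: covinf.
    by apply: card_le_lt piY_lt; rewrite (card_le_eql (card_setT B)).
  - exact: open_interior.
  - have BV : B (val V) by exact: set_valP.
    by apply: interior_xsection_dense => //; [exact: Bopen|exact: B0].
have [y yE] : \bigcap_a Exint a x !=set0.
  apply: bigcap_open_dense_neq0 => // [a|a O O0 Oopen]; first exact: open_interior.
  (* Density is tested on members of [B] alone, since each non-empty open set contains one. *)
  have [V BV VO] := Bnet O Oopen O0.
  have /interior_subset[w [Ew Vw]] := xW (a, exist _ V (mem_set BV)) I.
  by exists w; split=> //; exact: VO.
by exists (x, y) => a _; apply/xsectionP; exact: interior_subset (yE a I).
Qed.
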